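(* Let $\mathcal{I}$ be a proper admissible ideal on $\mathbb{N}$. For a zero-dimensional Tychonoff space $X$ the following assertions are equivalent. (1) $C_p(X,\mathbb{Q})$ is $\mathcal{I}$-H-separable. (2) $C_p(X,\mathbb{Z})$ is $\mathcal{I}$-H-separable. (3) $C_p(X,2)$ is $\mathcal{I}$-H-separable. (4) The $i$-weight of $X$ is countable, i.e. $iw(X)\leq\omega$, and every finite power of $X$ is $\mathcal{I}$-Hurewicz.
   Context: An ideal on $\mathbb{N}$ is a family of subsets of $\mathbb{N}$ closed under finite unions and under subsets; it is admissible if it contains every singleton and proper if it does not contain $\mathbb{N}$. A space is zero-dimensional if it has a base of clopen sets. For $T\subseteq\mathbb{R}$ with the subspace topology, $C_p(X,T)$ is the set of continuous functions $X\to T$ with the topology of pointwise convergence; $2=\{0,1\}$ is discrete. A space $Z$ is $\mathcal{I}$-H-separable if for every sequence $(Y_n)_{n\in\mathbb{N}}$ of dense subspaces of $Z$ there is a sequence $(F_n)_{n\in\mathbb{N}}$ such that each $F_n$ is a finite subset of $Y_n$ and for every nonempty open set $U$ of $Z$, $\{n\in\mathbb{N} : U\cap F_n=\emptyset\}\in\mathcal{I}$. The $i$-weight $iw(X)$ of $(X,\tau)$ is the least weight of a Tychonoff topology $\tau'\subseteq\tau$ on $X$. A space $Z$ is $\mathcal{I}$-Hurewicz if for each sequence $(\mathcal{U}_n)$ of open covers of $Z$ there is a sequence $(\mathcal{V}_n)$ such that each $\mathcal{V}_n$ is a finite subset of $\mathcal{U}_n$ and for each $z\in Z$, $\{n\in\mathbb{N}: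 z\notin\bigcup\mathcal{V}_n\}\in\mathcal{I}$. *)

(* Defs.v *)
From HB Require Import structures.
From mathcomp Require Import all_boot all_order all_algebra.
From mathcomp Require Import all_classical all_reals all_analysis.

Set Implicit Arguments.
Unset Strict Implicit.
Unset Printing Implicit Defensive.

Import Order.TTheory GRing.Theory Num.Theory.
Import numFieldNormedType.Exports.
Local Open Scope classical_set_scope.
Local Open Scope ring_scope.

(* The first clause is closure under the empty union. *)
Definition ideal_on_nat (I : set (set nat)) : Prop :=
  [/\ I set0,
      forall A B, I A -> I B -> I (A `|` B) &
      forall A B, A `<=` B -> I B -> I A].

Definition ideal_admissible (I : set (set nat)) : Prop := forall n : nat, I [set n].

Definition ideal_proper (I : set (set nat)) : Prop := ~ I setT.

(* The library's [zero_dimensional] only asks that distinct points be separated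
   by a clopen set, which for Hausdorff spaces is weaker. *)
Definition has_clopen_basis (X : topologicalType) : Prop :=
  exists2 B : set (set X), basis B & B `<=` clopen.

Definition tychonoff_space (X : topologicalType) : Prop :=
  hausdorff_space X /\ completely_regular_space X.

(* For A : set R, [Cp X A] is C_p(X, A): A is coerced to the type [set_type A],
   which carries the subspace topology. *)
Definition Cp (X Y : topologicalType) : topologicalType :=
  initial_topology (fun f : continuousType X Y => (f : {ptws X -> Y})).

Definition ideal_H_separable (I : set (set nat)) (Z : topologicalType) : Prop :=
  forall Y : nat -> set Z, (forall n, dense (Y n)) ->
  exists F : nat -> set Z,
    (forall n, finite_set (F n) /\ F n `<=` Y n) /\
    (forall U : set Z, open U -> U !=set0 -> I [set n | U `&` F n = set0]).

Definition open_cover (Z : topologicalType) (U : set (set Z)) : Prop :=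
  U `<=` open /\ \bigcup_(A in U) A = setT.

Definition ideal_Hurewicz (I : set (set nat)) (Z : topologicalType) : Prop :=
  forall U : nat -> set (set Z), (forall n, open_cover (U n)) ->
  exists V : nat -> set (set Z),
    (forall n, finite_set (V n) /\ V n `<=` U n) /\
    (forall z : Z, I [set n | ~ (\bigcup_(A in V n) A) z]).

(* w(X) <= |K| and iw(X) <= |K|. Both invariants are least cardinals, hence
   attained: the inequality holds iff some base, resp. some coarser Tychonoff
   topology on the carrier of X, has size, resp. weight, at most |K|. *)
Definition weight_le (X : topologicalType) (C : Type) (K : set C) : Prop :=
  exists2 B : set (set X), basis B & (B #<= K)%card.

Definition iweight_le (X : topologicalType) (C : Type) (K : set C) : Prop :=
  exists c : Topological.axioms_ X,
    let X' : topologicalType := Topological.Pack c in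
    [/\ (forall U : set X, @open X' U -> @open X U),
        tychonoff_space X' & weight_le X' K].

Definition rationals (R : realType) : set R := range (@ratr R).
Definition integers (R : realType) : set R := range (fun z : int => z%:~R).
Definition two (R : realType) : set R := [set 0; 1].
Arguments rationals : clear implicits.
Arguments integers : clear implicits.
Arguments two : clear implicits.

(* Main.v *)
Require Import Defs.
From mathcomp Require Import all_boot all_order all_algebra.
From mathcomp Require Import all_classical all_reals all_analysis.
Import numFieldNormedType.Exports.
Import Order.TTheory GRing.Theory Num.Theory.
Local Open Scope classical_set_scope.
Set Implicit Arguments.
Unset Strict Implicit.
Unset Printing Implicit Defensive.

(** The spaces of values are compared first. There are continuous retractions
  from the rationals onto the integers (cut the line at translates of an
  irrational number) and from the integers onto two points, and composing with
  a retraction onto a discrete space carries the selection property from one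
  function space to the other ([H_separable_retract]). The point is that dense
  sets pull back to dense sets: in a zero-dimensional space a continuous
  function can be changed at finitely many points inside prescribed
  neighbourhoods of these points ([clopen_interpolation]), so a value in the
  small space can be lifted wherever a basic open set asks for it. This gives
  (1) => (2) => (3).

  For (3) => (4), a selection from constantly full dense sets yields a
  countable dense set of two-valued functions; the diagonal map it defines
  into the Cantor space is injective, and the topology it induces is the
  required coarser one ([iweight_countable]). Given open covers U_k of X^n, the
  functions f such that the n-th power of {f = 1} is covered by finitely many
  members of U_k form a dense set; finite selections from these dense sets give
  finite subfamilies of the U_k, and a point z of X^n is covered at stage k as
  soon as the selection at stage k meets the basic open set of functions
  equal to 1 at all coordinates of z ([powers_Hurewicz]).

  For (4) => (1), the coarser topology provides countably many closed sets of X
  such that any finitely many distinct points lie in pairwise disjoint ones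
  ([iweight_closed_sets]). Together with a countable base of the space of
  values they provide countably many tests: disjoint closed sets C_1, ..., C_k
  and basic open sets G_1, ..., G_k. A dense set D of functions defines an open
  cover of the closed set C_1 x ... x C_k of X^k by the sets of points z such
  that f sends each z_i into G_i, one set for each f in D, and the Hurewicz
  property of X^k selects finitely many f from each of a sequence of dense sets
  ([Hurewicz_select]). A diagonal union over the tests then handles all basic
  open sets at once, at the cost of finitely many exceptional indices for each
  of them. *)

(** * Basic open sets in spaces of functions *)

(** The boxes with finitely many constrained coordinates form a filter base
  whose filter converges to [f] in each coordinate, hence in the product. *)
Lemma ptws_nbhs_box (T : choiceType) (Y : topologicalType)
    (f : {ptws T -> Y}) (N : set {ptws T -> Y}) : nbhs f N ->
  exists (s : seq T) (W : T -> set Y), (forall t, nbhs (f t) (W t)) /\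
    forall g : T -> Y, (forall t, t \in s -> W t (g t)) -> N g.
Proof.
move=> Nf.
pose D := [set sW : seq T * (T -> set Y) | forall t, nbhs (f t) (sW.2 t)].
pose F := filter_from D
  (fun sW => [set g : {ptws T -> Y} | forall t, t \in sW.1 -> sW.2 t (g t)]).
have FF : Filter F.
  apply: filter_from_filter => [|[s V] [s' V'] /= sV sV'].
    by exists ([::], fun=> setT) => t /=; exact: filterT.
  exists (s ++ s', fun t => V t `&` V' t) => [t /=|g /= gVV'].
    exact: filterI.
  by split=> t ts; case: (gVV' t); rewrite // mem_cat ts ?orbT.
have /(_ N Nf) [[s W] sW sWN] : F --> f.
  apply/cvg_sup => i A [_ [[B oB <-] Bf] sBA]; apply: filterS sBA _.
  exists ([:: i], fun t => if t == i then B else setT) => [t /=|g /=].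
    by case: eqP => [->|_]; [exact: open_nbhs_nbhs|exact: filterT].
  by move=> /(_ i); rewrite inE eqxx; exact.
by exists s, W; split.
Qed.

Lemma ptws_box_open (T : choiceType) (Y : topologicalType) (J : finType)
    (p : J -> T) (G : J -> set Y) : (forall j, open (G j)) ->
  open [set f : {ptws T -> Y} | forall j, G j (f (p j))].
Proof.
move=> oG; rewrite openE => f fG.
apply: (@filter_forall _ _ (fun j (g : {ptws T -> Y}) => G j (g (p j)))
  (nbhs f) (nbhs_filter f)) => j.
exact: (@proj_continuous T (fun=> Y) (p j) f _
  (open_nbhs_nbhs (conj (oG j) (fG j)))).
Qed.

Section Cp_boxes.
Context (X Y : topologicalType).

Lemma Cp_box_open (J : finType) (p : J -> X) (G : J -> set Y) :
  (forall j, open (G j)) -> open [set f : Cp X Y | forall j, G j (f (p j))].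
Proof.
move=> oG; exists [set f : {ptws X -> Y} | forall j, G j (f (p j))] => //.
exact: ptws_box_open.
Qed.

(** The points are taken distinct so that values at them can be prescribed
  independently by [clopen_interpolation]. *)
Lemma Cp_open_box (U : set (Cp X Y)) (f : Cp X Y) : open U -> U f ->
  exists n (p : 'I_n -> X) (G : 'I_n -> set Y),
    [/\ injective p, forall i, open (G i), forall i, G i (f (p i)) &
        forall g : Cp X Y, (forall i, G i (g (p i))) -> U g].
Proof.
move=> [V oV <-] Vf.
have [s [W [Wf WV]]] := @ptws_nbhs_box X Y f V (open_nbhs_nbhs (conj oV Vf)).
exists (size (undup s)), (tnth (in_tuple (undup s))),
  (fun i => interior (W (tnth (in_tuple (undup s)) i))); split.
- by apply/tuple_uniqP; exact: undup_uniq.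
- by move=> i; exact: open_interior.
- by move=> i; exact: Wf.
- move=> g gW; apply: WV => t; rewrite -mem_undup => /(tnthP (in_tuple _))[i ->].
  exact: interior_subset (gW i).
Qed.

End Cp_boxes.

(** * Interpolation by clopen sets *)

Section interpolation.
Context (X Y : topologicalType) (X_zd : has_clopen_basis X).

Lemma patch_continuous (C : set X) (f g : X -> Y) :
  clopen C -> continuous f -> continuous g -> continuous (patch g C f).
Proof.
move=> [oC cC] cf cg x A; rewrite /patch; have [xC|xC] := boolP (x \in C) => Av.
  have fA : nbhs x (f @^-1` A) := cf x A Av.
  have Cx : nbhs x C by apply: open_nbhs_nbhs; split=> //; exact: set_mem.
  have : nbhs x (f @^-1` A `&` C) by exact: filterI.
  by apply: filterS => y [Ay Cy] /=; rewrite mem_set.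
have nCx : nbhs x (~` C).
  apply: open_nbhs_nbhs; split; first exact: closed_openC.
  by move/negP: xC; rewrite inE.
have gA : nbhs x (g @^-1` A) := cg x A Av.
have : nbhs x (g @^-1` A `&` ~` C) by exact: filterI.
by apply: filterS => y [Ay nCy] /=; rewrite memNset.
Qed.

(** Each point [p j] has a clopen neighbourhood inside [N j] that avoids the
  other points; the function is reset to [v j] there, one [j] after the other.
  The second part of the conclusion controls the new function everywhere: it is
  what makes the retraction argument and the density argument for covers
  work. *)
Lemma clopen_interpolation (J : finType) (p : J -> X) (v : J -> Y)
    (N : J -> set X) (f : continuousType X Y) : hausdorff_space X ->
  injective p -> (forall j, nbhs (p j) (N j)) ->
  exists g : continuousType X Y, (forall j, g (p j) = v j) /\
    forall x, g x = f x \/ exists2 j, N j x & g x = v j.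
Proof.
move=> hX inj_p Np; have [B [Bo Bx] Bclopen] := X_zd.
have clP j : exists C, [/\ clopen C, C (p j), C `<=` N j &
    forall i, i != j -> ~ C (p i)].
  have : nbhs (p j) (N j `&` [set x | forall i, i != j -> x != p i]).
    apply: filterI => //; apply: filter_forall => i.
    have [->|ij] := eqVneq i j; first exact: nearW.
    have : open_nbhs (p j) (~` [set p i]).
      split; last by move/inj_p => /eqP; rewrite eq_sym (negPf ij).
      exact/closed_openC/accessible_closed_set1/hausdorff_accessible.
    by move/open_nbhs_nbhs; apply: filterS => x /eqP.
  move=> /Bx [C [BC Cj] sC]; exists C; split; first exact: Bclopen.
  - by [].
  - by move=> x /sC[].
  - by move=> i ij /sC[_ /(_ i ij)]; rewrite eqxx.
have {clP}[C CP] := choice clP.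
(* Only the values at the points of [s] are prescribed so far. *)
suff H (s : seq J) : exists g : continuousType X Y,
    (forall j, j \in s -> g (p j) = v j) /\
    forall x, g x = f x \/ exists2 j, N j x & g x = v j.
  have [g [gp gf]] := H (enum J); exists g; split=> // j.
  by apply: gp; rewrite mem_enum.
elim: s => [|j s [g [gp gf]]]; first by exists f; split=> // x; left.
have [clC Cj CN Cother] := CP j.
have cv : continuous (cst (v j) : X -> Y) by exact: cst_continuous.
exists (mkcts (patch_continuous clC cv (@cts_fun _ _ g))).
split=> [i|x]; rewrite /= /mkcts /patch.
  rewrite inE; case: eqVneq => [->|ij] /= si; first by rewrite mem_set.
  by rewrite memNset ?gp//; exact: Cother.
by case: ifPn => [/set_mem /CN Nx|_]; [right; exists j|exact: gf].
Qed.

End interpolation.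

(** * Retractions of the space of values *)

(** If [g] in [D n] takes the value [r (f (p j))] at each [p j], the
  interpolation of [g] that takes the value [f (p j)] at [p j], and only where
  [g] equals [r (f (p j))], still retracts to [g]. Hence the preimage of [D n]
  is dense. Discreteness of [T] makes the sets where [g] has a given value
  open. *)
Lemma H_separable_retract (I : set (set nat)) (X S T : topologicalType)
    (i : T -> S) (r : S -> T) :
  ideal_on_nat I -> has_clopen_basis X -> hausdorff_space X ->
  (forall t : T, open [set t]) -> continuous r -> cancel i r ->
  ideal_H_separable I (Cp X S) -> ideal_H_separable I (Cp X T).
Proof.
move=> I_ideal zX hX dT cr iK HS D denseD.
have ci : continuous i.
  move=> t A Ait; have := open_nbhs_nbhs (conj (dT t) (erefl t)).
  by apply: filterS => _ ->; exact: (nbhs_singleton Ait).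
pose rc : continuousType S T := mkcts cr.
pose ic : continuousType T S := mkcts ci.
pose rX (f : Cp X S) : Cp X T := (rc \o f : continuousType X T).
have rX_cont (U : set (Cp X T)) : open U -> open (rX @^-1` U).
  move=> oU; rewrite openE => f /= Uf.
  have [n [p [G [_ oG Gf GU]]]] := Cp_open_box oU Uf.
  rewrite /interior nbhsE.
  exists [set g : Cp X S | forall j, (r @^-1` G j) (g (p j))].
    split=> //; apply: (@Cp_box_open _ _ _ p (fun j => r @^-1` G j)) => j.
    by have /continuousP := cr; apply.
  by move=> g gG; apply: GU.
have denseE n : dense (rX @^-1` (D n)).
  move=> W [f Wf] oW.
  have [k [p [G [inj_p oG Gf GW]]]] := Cp_open_box oW Wf.
  have oV : open [set g : Cp X T | forall j, [set r (f (p j))] (g (p j))].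
    exact: (@Cp_box_open _ _ _ p (fun j => [set r (f (p j))])).
  have [|g [gV gD]] := denseD n _ _ oV; first by exists (rX f).
  have [h [hp hg]] := clopen_interpolation zX (fun j => f (p j))
    (N := fun j => g @^-1` [set r (f (p j))]) (ic \o g) hX inj_p
    (fun j => @cts_fun _ _ g (p j) _
      (open_nbhs_nbhs (conj (dT (r (f (p j)))) (gV j)))).
  exists h; split; first by apply: GW => j; rewrite hp.
  suff -> : (rX @^-1` D n) h = D n g by [].
  rewrite /preimage /=; congr (D n _); apply/continuousEP => x /=.
  rewrite /rc /mkcts; have [->|[j gx ->]] := hg x; last exact: esym gx.
  by rewrite /= /ic /mkcts iK.
have [F [FD FI]] := HS _ denseE.
exists (fun n => rX @` F n); split=> [n|U oU [g Ug]].
  have [finF FDn] := FD n; split; first exact: finite_image.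
  by move=> _ [f /FDn ? <-].
have rXg : (rX @^-1` U) !=set0.
  exists (ic \o g : continuousType X S); rewrite /preimage /=.
  suff -> : rX (ic \o g : continuousType X S) = g by [].
  by apply/continuousEP => x /=; rewrite /rc /ic /mkcts iK.
have [_ _ I_sub] := I_ideal; apply: I_sub (FI _ (rX_cont U oU) rXg).
move=> n /= UF0; apply/seteqP; split=> // f [Uf Ff].
suff : (U `&` rX @` F n) (rX f) by rewrite UF0.
by split=> //; exists f.
Qed.

(** * Countability *)

(** The default value [x0] is there for the empty set. *)
Lemma countable_enum (T : Type) (x0 : T) (D : set T) : countable D ->
  exists e : nat -> T, (forall n, D (e n) \/ e n = x0) /\
    forall x, D x -> exists n, e n = x.
Proof.
move=> /pfcard_geP[->|[e]].
  by exists (fun=> x0); split=> [n|x []]; right.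
exists e; split=> [n|x /(@surj _ _ _ _ e)[n _ <-]]; last by exists n.
by left; exact: funS.
Qed.

Lemma second_countable_initial (S : choiceType) (T : topologicalType)
    (f : S -> T) : @second_countable T -> @second_countable (initial_topology f).
Proof.
move=> [B cB [oB Bx]]; exists [set f @^-1` A | A in B].
  exact: card_le_trans (card_image_le _ _) cB.
split=> [_ [A /oB oA <-]|x N [_ [[A oA <-] Afx] AN]]; first by exists A.
have [C [BC Cfx] CA] := Bx _ _ (open_nbhs_nbhs (conj oA Afx)).
by exists (f @^-1` C); [split=> //; exists C | move=> y /CA /AN].
Qed.

(** The basic sets are the cylinders over finite words: a box around [f] that
  constrains the coordinates in [s] contains the cylinder over an initial
  segment of [f] longer than every index in [s]. *)
Lemma second_countable_cantor : @second_countable cantor_space.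
Proof.
pose cyl (t : seq bool) : set cantor_space :=
  [set g | forall i : 'I_(size t), [set nth false t i] (g i)].
exists (range cyl).
  by apply: card_le_trans (card_image_le _ _) _; exact: countableP.
split=> [_ [t _ <-]|f N /(@ptws_nbhs_box nat)[s [W [Wf WN]]]].
  apply: (@ptws_box_open nat bool 'I_(size t) (fun i => val i)
    (fun i => [set nth false t i])) => i.
  exact: discrete_open.
pose n := \max_(i <- s) i.+1.
exists (cyl (mkseq f n)).
  split=> [|i]; first by exists (mkseq f n).
  rewrite /= nth_mkseq//.
  by have := ltn_ord i; rewrite [X in (_ < X)%N]size_mkseq.
move=> g /= gf; apply: WN => i si.
have lt_in : (i < size (mkseq f n))%N.
  by rewrite size_mkseq /n (big_rem i si) /= leq_max ltnSn.
have := gf (Ordinal lt_in).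
rewrite /= nth_mkseq; last by rewrite size_mkseq in lt_in.
by move=> ->; exact: nbhs_singleton.
Qed.

(** * From selections in the function space to covers *)

(** Select from the whole space: an open set missed by every selection would
  put the set of all indices in the ideal. *)
Lemma H_separable_separable (I : set (set nat)) (Z : topologicalType) :
  ideal_proper I -> ideal_H_separable I Z ->
  exists2 D : set Z, countable D & dense D.
Proof.
move=> I_proper /(_ (fun=> setT)) [|F [finF FI]].
  by move=> _ U [z Uz] _; exists z.
exists (\bigcup_n F n).
  by apply: bigcup_countable => // n _; have [/finite_set_countable] := finF n.
move=> U U0 oU; apply: contrapT => UF; apply: I_proper.
have -> // : setT = [set n | U `&` F n = set0]; last exact: FI.
apply/seteqP; split=> // n _ /=; apply/seteqP; split=> // z [Uz Fz].
by apply: UF; exists z; split=> //; exists n.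
Qed.

(** A countable dense set of functions separates points, since it meets the open
  set of functions with values [b] at [x] and [a] at [y]. Recording where these
  functions equal [b] embeds [X] injectively and continuously in the Cantor
  space, whose induced topology is uniformizable, Hausdorff and second
  countable. The real field only serves to know that uniform spaces are
  completely regular. *)
Lemma iweight_countable (R : realType) (X T : topologicalType) (a b : T) :
  has_clopen_basis X -> hausdorff_space X -> (forall t : T, open [set t]) ->
  a <> b -> (exists2 D : set (Cp X T), countable D & dense D) ->
  iweight_le X [set: nat].
Proof.
move=> zX hX dT ab [D cD denseD].
have ca : continuous (cst a : X -> T) by exact: cst_continuous.
pose ka : continuousType X T := mkcts ca.
have [e [_ De]] := @countable_enum (Cp X T) ka D cD.
pose Phi x : cantor_space := fun n => e n x == b.
have Phi_cont : continuous Phi.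
  move=> x N /(@ptws_nbhs_box nat)[s [W [Wf WN]]].
  suff : nbhs x [set y | forall n : seq_sub s, e (val n) y = e (val n) x].
    apply: filterS => y eyx; apply: WN => n sn; rewrite /Phi.
    by rewrite (eyx (SeqSub sn)); exact: nbhs_singleton (Wf n).
  apply: filter_forall => n.
  exact: (@cts_fun _ _ (e (val n)) x _ (open_nbhs_nbhs (conj (dT _) erefl))).
have Phi_inj : injective Phi.
  move=> x y xy; apply: contrapT => /eqP xNy.
  pose p (i : bool) := if i then x else y.
  pose v (i : bool) := if i then b else a.
  have p_inj : injective p.
    by move=> [] [] //= /eqP; rewrite ?(negPf xNy)// eq_sym (negPf xNy).
  have [g [gp _]] := clopen_interpolation zX v (N := fun=> setT) ka hX p_inj
    (fun=> filterT).
  have [||f [fv Df]] := denseD [set f : Cp X T | forall i, [set v i] (f (p i))].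
  - by exists g.
  - by apply: (@Cp_box_open _ _ _ p (fun i => [set v i])) => i; exact: dT.
  have [n en] := De _ Df.
  have := congr1 (fun h : cantor_space => h n) xy.
  by rewrite /Phi en (fv true) (fv false) /= eqxx => /esym /eqP /ab.
exists (Topological.class (initial_topology Phi)); split.
- by move=> _ [A oA <-]; move/continuousP: Phi_cont; apply.
- split; last exact: (@uniform_completely_regular R (initial_topology Phi)).
  rewrite open_hausdorff => x y xNy.
  have := cantor_space_hausdorff; rewrite open_hausdorff => /(_ (Phi x) (Phi y)).
  case; first by rewrite (inj_eq Phi_inj).
  move=> [A B] /= [/set_mem Ax /set_mem By] [oA oB /eqP AB0].
  exists (Phi @^-1` A, Phi @^-1` B); first by split; exact: mem_set.
  split; [by exists A | by exists B | rewrite -preimage_setI AB0].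
  by rewrite preimage_set0.
- have [B cB bB] := @second_countable_initial X _ Phi second_countable_cantor.
  by exists B.
Qed.

(** Here [covered f V] says that the family [V] covers the n-th power of the set
  where [f] equals [b]. Functions with this property for a finite subfamily of
  the k-th cover are dense: given finitely many points [p j], choose a member of
  the cover around each n-tuple of them, shrink to a neighbourhood [N j] of each
  point so small that the corresponding products stay inside the chosen
  members, and interpolate so that the value [b] is only taken inside the
  [N j]. *)
Lemma powers_Hurewicz (I : set (set nat)) (X T : topologicalType) (a b : T) :
  ideal_on_nat I ->
  has_clopen_basis X -> hausdorff_space X -> (forall t : T, open [set t]) ->
  a <> b -> ideal_H_separable I (Cp X T) ->
  forall n : nat, ideal_Hurewicz I {ptws 'I_n -> X}.
Proof.
move=> [_ _ I_sub] zX hX dT ab HS n U coverU.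
have ca : continuous (cst a : X -> T) by exact: cst_continuous.
pose ka : continuousType X T := mkcts ca.
have cb : continuous (cst b : X -> T) by exact: cst_continuous.
pose kb : continuousType X T := mkcts cb.
pose covered (f : Cp X T) (V : set (set {ptws 'I_n -> X})) :=
  [set z : {ptws 'I_n -> X} | forall i, f (z i) = b] `<=` \bigcup_(A in V) A.
pose Y k : set (Cp X T) :=
  [set f | exists V, [/\ finite_set V, V `<=` U k & covered f V]].
have denseY k : dense (Y k).
  move=> O [f Of] oO; have [m [p [G [p_inj oG Gf GO]]]] := Cp_open_box oO Of.
  have [oU UT] := coverU k.
  pose z (s : {ffun 'I_n -> 'I_m}) : {ptws 'I_n -> X} := fun i => p (s i).
  have VP (s : {ffun 'I_n -> 'I_m}) : exists A, U k A /\ A (z s).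
    have : setT (z s) by [].
    by rewrite -UT => -[A UA Az]; exists A.
  have {VP}[V VP] := choice VP.
  have WP (s : {ffun 'I_n -> 'I_m}) : exists W : 'I_n -> set X,
      (forall i, nbhs (p (s i)) (W i)) /\
      forall g : 'I_n -> X, (forall i, W i (g i)) -> V s g.
    have [UV Vz] := VP s.
    have [l [W [Wz WV]]] := @ptws_nbhs_box 'I_n X (z s) (V s)
      (open_nbhs_nbhs (conj (oU _ UV) Vz)).
    by exists W; split=> // g gW; apply: WV => i _; exact: gW.
  have {WP}[W WP] := choice WP.
  pose N j := [set x | forall (si : {ffun 'I_n -> 'I_m} * 'I_n),
    si.1 si.2 = j -> W si.1 si.2 x].
  have Np j : nbhs (p j) (N j).
    apply: filter_forall => -[s i] /=.
    have [<-|sij] := eqVneq (s i) j.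
      by have := (WP s).1 i; apply: filterS => x Wx _.
    by apply: nearW => x /eqP; rewrite (negPf sij).
  have [g [gp gf]] := clopen_interpolation zX (fun j => f (p j)) ka hX p_inj Np.
  exists g; split; first by apply: GO => j; rewrite gp.
  exists (range V); split.
  - by apply: finite_image; exact: finite_finset.
  - by move=> _ [s _ <-]; exact: (VP s).1.
  - move=> x /= gx.
    (* Off the [N j], [g] equals the constant [a], which is not [b]. *)
    have jP i : exists j, N j (x i).
      by have [ga|[j Nj _]] := gf (x i); [case: ab; rewrite -(gx i) ga|exists j].
    have [s sP] := choice jP.
    exists (V (finfun s)); first by exists (finfun s).
    apply: (WP _).2 => i; apply: (sP i (finfun s, i)) => /=.
    by rewrite ffunE.
have [F [FY FI]] := HS _ denseY.
pose P k (fV : Cp X T -> set (set {ptws 'I_n -> X})) := forall f, F k f ->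
  [/\ finite_set (fV f), fV f `<=` U k & covered f (fV f)].
have fVP k : exists fV, P k fV.
  have VP f : exists V, F k f -> [/\ finite_set V, V `<=` U k & covered f V].
    have [/(FY k).2[V VP]|nF] := pselect (F k f); first by exists V.
    by exists set0 => /nF.
  by have [fV fVP] := choice VP; exists fV.
have [fV {}fVP] := choice fVP.
exists (fun k => \bigcup_(f in F k) fV k f); split=> [k|z].
  split; first by apply: bigcup_finite; [exact: (FY k).1|move=> f /fVP[]].
  by move=> A [f /fVP[_ + _]]; apply.
pose O := [set f : Cp X T | forall i, [set b] (f (z i))].
have oO : open O by apply: (@Cp_box_open _ _ _ z (fun=> [set b])).
apply: I_sub (FI O oO _); last by exists kb.
move=> k /= zV; apply/seteqP; split=> // f [Of Ff].
have [_ _ /(_ z Of)[A fVA Az]] := fVP k f Ff.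
by apply: zV; exists A => //; exists f.
Qed.

(** * From covers to selections in the function space *)

(** The closed sets are the closures of basic sets in the coarser topology:
  distinct points have disjoint open neighbourhoods there, and regularity
  allows to shrink these to closures of basic sets. *)
Lemma iweight_closed_sets (R : realType) (X : topologicalType) :
  iweight_le X [set: nat] -> exists C : nat -> set X,
    (forall n, closed (C n)) /\
    forall (J : finType) (p : J -> X), injective p ->
    exists c : J -> nat, (forall j, C (c j) (p j)) /\
      forall i j, i != j -> C (c i) `&` C (c j) = set0.
Proof.
move=> [ax [coarser [hX' crX'] [B [oB Bx] cB]]].
set X' := Topological.Pack ax in coarser hX' crX' oB Bx.
have regX' := @completely_regular_regular R X' crX'.
have [b [_ bP]] := countable_enum (set0 : set X') cB.
exists (fun n => @closure X' (b n)); split=> [n|J p p_inj].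
  rewrite -[X in closed X]setCK; apply/open_closedC/coarser.
  exact/closed_openC/closed_closure.
have ABP (ij : J * J) : exists AB : set X' * set X', ij.1 != ij.2 ->
    [/\ nbhs (p ij.1 : X') AB.1, nbhs (p ij.2 : X') AB.2 & AB.1 `&` AB.2 = set0].
  have [->|ij12] := eqVneq ij.1 ij.2; first by exists (setT, setT).
  move: hX'; rewrite open_hausdorff => /(_ (p ij.1) (p ij.2)).
  case; first by apply: contra_neq ij12 => /p_inj.
  move=> AB [/set_mem Ai /set_mem Bj] [oA oB' /eqP AB0]; exists AB => _.
  by split=> //; exact: open_nbhs_nbhs.
have {ABP}[AB ABP] := choice ABP.
pose O i : set X' := [set x | forall j, i != j ->
  (AB (i, j)).1 x /\ (AB (j, i)).2 x].
have cP i : exists n, b n (p i) /\ @closure X' (b n) `<=` O i.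
  have nO : nbhs (p i : X') (O i).
    apply: (@filter_forall _ _ (fun j (x : X') => i != j ->
      (AB (i, j)).1 x /\ (AB (j, i)).2 x) _ (nbhs_filter (p i : X'))) => j.
    have [->|ij] := eqVneq i j; first exact: nearW.
    have [Ai _ _] := ABP (i, j) ij.
    have [|_ Bi _] := ABP (j, i); first by rewrite eq_sym.
    have : nbhs (p i : X') ((AB (i, j)).1 `&` (AB (j, i)).2).
      by apply: (@filterI _ _ (nbhs_filter (p i : X'))).
    by apply: (@filterS _ _ (nbhs_filter (p i : X'))) => x [].
  have [N nN NO] := regX' _ _ nO.
  have [V [BV Vp] VN] := Bx _ _ nN.
  have [n bn] := bP V BV; exists n; rewrite bn; split=> //.
  by apply: subset_trans NO; exact: closureS.
have [c {}cP] := choice cP; exists c; split=> [j|i j ij].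
  exact: subset_closure (cP j).1.
apply/seteqP; split=> // x [/(cP i).2 Oi /(cP j).2 Oj].
have [_ _ <-] := ABP (i, j) ij; split; first exact: (Oi j ij).1.
by apply: (Oj i _).2; rewrite eq_sym.
Qed.

Lemma finite_subset_image_lift (T U : Type) (O : T -> U) (D : set T)
    (A : set U) : finite_set A -> A `<=` O @` D ->
  exists B, [/\ finite_set B, B `<=` D & A `<=` O @` B].
Proof.
move=> finA AD.
have SP u : exists S, [/\ finite_set S, S `<=` D & A u -> (O @` S) u].
  have [/AD[t Dt Otu]|nA] := pselect (A u); last by exists set0; split.
  by exists [set t]; split=> [|_ ->|_] //; exists t.
have [S {}SP] := choice SP.
exists (\bigcup_(u in A) S u); split.
- by apply: bigcup_finite => // u _; have [] := SP u.
- by move=> t [u _]; have [_ + _] := SP u; apply.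
- move=> u Au; have [_ _ /(_ Au)[t St Otu]] := SP u.
  by exists t => //; exists u.
Qed.

(** The points of [K] have distinct coordinates, so for every [z] in [K] some
  function in the dense set [D n] sends each [z i] into [G i]: the open sets
  [O f], for [f] in [D n], cover [K], and with the complement of [K] they cover
  the whole power. *)
Lemma Hurewicz_select (I : set (set nat)) (X Y : topologicalType) (y0 : Y)
    (k : nat) (K : set {ptws 'I_k -> X}) (G : 'I_k -> set Y)
    (D : nat -> set (Cp X Y)) :
  ideal_on_nat I -> has_clopen_basis X -> hausdorff_space X ->
  ideal_Hurewicz I {ptws 'I_k -> X} ->
  closed K -> (forall z, K z -> injective z) ->
  (forall i, open (G i)) -> (forall i, G i !=set0) ->
  (forall n, dense (D n)) ->
  exists F : nat -> set (Cp X Y),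
    (forall n, finite_set (F n) /\ F n `<=` D n) /\
    forall z, K z ->
      I [set n | ~ exists2 f, F n f & forall i, G i (f (z i))].
Proof.
move=> [_ _ I_sub] zX hX Hur cK K_inj oG G0 denseD.
pose O (f : Cp X Y) := [set z : {ptws 'I_k -> X} | forall i, (f @^-1` G i) (z i)].
have oO f : open (O f).
  apply: (@ptws_box_open _ _ _ id (fun i => f @^-1` G i)) => i.
  by have /continuousP := @cts_fun _ _ f; apply.
have [y yG] := choice G0.
have c0 : continuous (cst y0 : X -> Y) by exact: cst_continuous.
have coverU n : open_cover (~` K |` O @` D n).
  split=> [_ [->|[f _ <-]]|]; [exact: closed_openC|exact: oO|].
  apply/seteqP; split=> // z _; have [Kz|nKz] := pselect (K z); last first.
    by exists (~` K) => //; left.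
  have [g [gz _]] := clopen_interpolation zX y (N := fun=> setT) (mkcts c0) hX
    (K_inj z Kz) (fun=> filterT).
  have [||f [fG Df]] := denseD n [set f : Cp X Y | forall i, G i (f (z i))].
  - by exists g => i; rewrite gz.
  - exact: Cp_box_open.
  - by exists (O f) => //; right; exists f.
have [V [VU VI]] := Hur _ coverU.
have FP n : exists F,
    [/\ finite_set F, F `<=` D n & V n `&` O @` D n `<=` O @` F].
  apply: finite_subset_image_lift; last exact: subIsetr.
  by apply: finite_setI; left; exact: (VU n).1.
have [F {}FP] := choice FP; exists F; split=> [n|z Kz].
  by have [] := FP n.
apply: I_sub (VI z) => n /= nF [A VA Az]; apply: nF.
have [_ _ sF] := FP n; have [AK|DA] := (VU n).2 A VA.
  by move: Az; rewrite AK.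
by have [f Ff OfA] := sF A (conj VA DA); exists f => //; move: Az; rewrite -OfA.
Qed.

Lemma ideal_initial_segment (I : set (set nat)) (N : nat) :
  ideal_on_nat I -> ideal_admissible I -> I [set n | (n < N)%N].
Proof.
move=> [I0 IU I_sub] adm; elim: N => [|N IH]; first exact: I_sub I0.
apply: I_sub (IU _ _ IH (adm N)) => n /=.
by rewrite ltnS leq_eqVlt => /orP[/eqP|]; [right|left].
Qed.

(** A test of length [k] lists, for each of [k] coordinates, the index of a
  closed set of [X] and the index of a basic set of [Y]. Only the good tests
  give rise to a selection, but there are countably many tests in all, and every
  basic open set of functions contains the one described by some good test. *)
Lemma H_separable_of_powers_Hurewicz (R : realType) (I : set (set nat))
    (X Y : topologicalType) (y0 : Y) :
  ideal_on_nat I -> ideal_admissible I ->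
  has_clopen_basis X -> hausdorff_space X -> @second_countable Y ->
  iweight_le X [set: nat] ->
  (forall n : nat, ideal_Hurewicz I {ptws 'I_n -> X}) ->
  ideal_H_separable I (Cp X Y).
Proof.
move=> I_ideal adm zX hX [B cB [oB By]] iwX Hur D denseD.
have [_ IU I_sub] := I_ideal.
have [C [cC CP]] := iweight_closed_sets R iwX.
have [b [bB bP]] := countable_enum (set0 : set Y) cB.
have ob n : open (b n) by case: (bB n) => [/oB//|->]; exact: open0.
pose test := {k : nat & {ffun 'I_k -> nat * nat}}.
pose good (t : test) := (forall i, b (tagged t i).2 !=set0) /\
  forall i j, i != j -> C (tagged t i).1 `&` C (tagged t j).1 = set0.
have FP (t : test) : exists F : nat -> set (Cp X Y),
    (forall n, finite_set (F n) /\ F n `<=` D n) /\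
    (good t -> forall z, (forall i, C (tagged t i).1 (z i)) ->
      I [set n | ~ exists2 f, F n f & forall i, b (tagged t i).2 (f (z i))]).
  have [[b0 C0]|ngood] := pselect (good t); last first.
    by exists (fun=> set0); split=> // n; split.
  pose K := [set z : {ptws 'I_(tag t) -> X} | forall i, C (tagged t i).1 (z i)].
  have cK : closed K.
    rewrite -[X in closed X]setCK; apply: open_closedC.
    have -> : ~` K = \bigcup_i
        [set z : {ptws 'I_(tag t) -> X} | (~` C (tagged t i).1) (z i)].
      apply/seteqP; split=> [z /existsNP[i ?]|z [i _ /= ?]]; first by exists i.
      by apply/existsNP; exists i.
    apply: bigcup_open => i _.
    have := @ptws_box_open 'I_(tag t) X unit (fun=> i)
      (fun=> ~` C (tagged t i).1) (fun=> closed_openC (cC _)).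
    congr open; apply/seteqP; split=> z /= => [/(_ tt)|]; exact.
  have K_inj z : K z -> injective z.
    move=> Cz i j zij; apply: contrapT => /eqP ij.
    have : (C (tagged t i).1 `&` C (tagged t j).1) (z i).
      by split; [exact: Cz|rewrite zij; exact: Cz].
    by rewrite C0.
  have [F [FD FI]] := Hurewicz_select y0 I_ideal zX hX (Hur _) cK K_inj
    (fun i => ob (tagged t i).2) b0 denseD.
  by exists F.
have [F {}FP] := choice FP.
(* The selection for a test only enters from the index of the test onwards,
   which keeps the n-th selection finite. *)
exists (fun n => \bigcup_(t in [set t | (pickle t <= n)%N]) F t n).
split=> [n|U oU [f Uf]].
  split; last by move=> g [t _]; exact: ((FP t).1 n).2.
  apply: bigcup_finite => [|t _]; last exact: ((FP t).1 n).1.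
  apply: (@finite_preimage _ _ [set m | (m <= n)%N] pickle).
    by move=> t u _ _; exact: (pcan_inj pickleK).
  by rewrite -[X in finite_set X]/(`I_n.+1); exact: finite_II.
have [k [p [G [p_inj oG Gf GU]]]] := Cp_open_box oU Uf.
have [c [Cc cC0]] := CP _ p p_inj.
have dP i : exists d, b d (f (p i)) /\ b d `<=` G i.
  have [V [BV Vf] VG] := By _ _ (open_nbhs_nbhs (conj (oG i) (Gf i))).
  by have [d bd] := bP V BV; exists d; rewrite bd.
have [d {}dP] := choice dP.
pose t : test :=
  Tagged (fun k => {ffun 'I_k -> nat * nat}) [ffun i => (c i, d i)].
have good_t : good t.
  split=> [i|i j ij].
    by exists (f (p i)); rewrite /= ffunE; exact: (dP i).1.
  by rewrite /= !ffunE; exact: cC0.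
have Ct (i : 'I_(tag t)) : C (tagged t i).1 (p i).
  by rewrite /= ffunE; exact: Cc.
apply: I_sub (IU _ _ (ideal_initial_segment (pickle t) I_ideal adm)
  ((FP t).2 good_t p Ct)) => n /= UF0.
have [tn|nt] := leqP (pickle t) n; last by left.
right=> -[g Fg gp].
suff : (U `&` \bigcup_(t in [set t | (pickle t <= n)%N]) F t n) g by rewrite UF0.
split; last by exists t.
by apply: GU => i; apply: (dP i).2; have := gp i; rewrite /= ffunE.
Qed.

(** * Rationals, integers and two points *)

Section real_subspaces.
Local Open Scope ring_scope.
Context (R : realType).

Lemma second_countable_real : @second_countable R.
Proof.
pose J (q : rat * rat) : set R := `]ratr q.1, ratr q.2[%classic.
exists (range J).
  by apply: card_le_trans (card_image_le _ _) _; exact: countableP.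
split=> [_ [q _ <-]|x N /nbhs_ballP[_/posnumP[e] eN]]; first exact: itv_open.
have /rat_in_itvoo[a /itvP ax] : x - e%:num < x by rewrite ltrBlDr ltrDl.
have /rat_in_itvoo[b /itvP xb] : x < x + e%:num by rewrite ltrDl.
exists (J (a, b)); first split; first by exists (a, b).
  by rewrite /J /= in_itv /= ax xb.
move=> y; rewrite /J /= in_itv /= => /andP[ay yb]; apply: eN.
rewrite /ball /= distrC ltr_distl (le_lt_trans _ ay) ?ax//=.
by rewrite (lt_le_trans yb) ?xb.
Qed.

Lemma set_type_integers_discrete (A : set R) :
  A `<=` integers R -> forall t : A, open [set t].
Proof.
move=> AZ t; exists (ball (val t) 1); first exact: ball_open.
apply/seteqP; split=> [s|_ ->]; last exact: ballxx.
rewrite /ball /= => st; apply: val_inj.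
have [m _ mt] := AZ _ (set_valP t); have [n _ ns] := AZ _ (set_valP s).
have : `|m%:~R - n%:~R| < 1 :> R by rewrite mt ns.
rewrite -mt -ns -intrB -intr_norm -[1]/(1%:~R) ltr_int.
move=> mn; congr _%:~R; apply/eqP; rewrite eq_sym -subr_eq0 -normr_le0.
by rewrite -ltzD1 add0r.
Qed.

Definition in_subspace (T : Type) (A : set T) (x : T) (Ax : A x) : A :=
  exist _ x (mem_set Ax).

Lemma integer_is_rational (z : integers R) : rationals R (val z).
Proof.
by have [m _ <-] := set_valP z; exists m%:~R => //; rewrite ratr_int.
Qed.

Definition rational_of_integer (z : integers R) : rationals R :=
  in_subspace (integer_is_rational z).

(** Rounding down after the shift by [pi] jumps only at irrational points;
  subtracting [floor pi] makes it fix the integers. *)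
Definition round_rational (q : rationals R) : integers R :=
  in_subspace (imageT (fun z : int => z%:~R : R)
    (Num.floor (val q + pi) - Num.floor (pi : R))).

Lemma rational_of_integerK : cancel rational_of_integer round_rational.
Proof.
move=> z; apply: val_inj; have [m _ mz] := set_valP z => /=.
by rewrite -mz floorDzr ?intr_int// intrKfloor addrK.
Qed.

Lemma round_rational_continuous : continuous round_rational.
Proof.
move=> q N Nrq.
have /andP[mq qm] := floor_itv (val q + pi : R).
set m := Num.floor _ in mq qm.
have mNq : m%:~R != val q + pi :> R.
  apply/eqP => mE; apply: (@pi_irrationnal R).
  have [a _ aq] := set_valP q.
  exists (m%:~R - a) => //.
  by rewrite rmorphB /= ratr_int aq mE addrC addKr.
(* On this interval around [q] the rounded value is constant; [q] is not its
   left end because [m - pi] is irrational. *)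
have : nbhs q (set_val @^-1` `]m%:~R - pi, (m + 1)%:~R - pi[%classic).
  apply: open_nbhs_nbhs; split; last first.
    by rewrite /= in_itv /= ltrBlDr ltrBrDr qm lt_neqAle mNq mq.
  by exists `]m%:~R - pi, (m + 1)%:~R - pi[%classic => //; exact: itv_open.
apply: filterS => p /=; rewrite in_itv /= ltrBlDr ltrBrDr => /andP[mp pm].
suff -> : round_rational p = round_rational q by exact: nbhs_singleton Nrq.
apply: val_inj => /=; congr (_ - _)%:~R.
by rewrite -/m; apply: floor_def; rewrite pm ltW.
Qed.

Lemma two_is_integer (t : two R) : integers R (val t).
Proof. by have [->|->] := set_valP t; [exists 0 | exists 1]. Qed.

Definition integer_of_two (t : two R) : integers R :=
  in_subspace (two_is_integer t).

Definition two0 : two R := in_subspace (or_introl erefl).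
Definition two1 : two R := in_subspace (or_intror erefl).

Definition two_of_integer (z : integers R) : two R :=
  if val z == 0 then two0 else two1.

Lemma integer_of_twoK : cancel integer_of_two two_of_integer.
Proof.
move=> t; apply: val_inj; rewrite /two_of_integer /=.
by have [->|->] := set_valP t; rewrite ?eqxx ?oner_eq0.
Qed.

End real_subspaces.

Theorem theorem3p38 (R : realType) (I : set (set nat)) (X : topologicalType)
    (I_ideal : ideal_on_nat I) (I_proper : ideal_proper I)
    (I_admissible : ideal_admissible I)
    (X_zero_dim : has_clopen_basis X) (X_tychonoff : tychonoff_space X) :
  [<-> ideal_H_separable I (Cp X (rationals R));
       ideal_H_separable I (Cp X (integers R));
       ideal_H_separable I (Cp X (two R));
       iweight_le X [set: nat] /\
         (forall n : nat, ideal_Hurewicz I {ptws 'I_n -> X})].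
Proof.
have [hX _] := X_tychonoff.
have discZ : forall t : integers R, open [set t].
  exact: set_type_integers_discrete.
have disc2 : forall t : two R, open [set t].
  by apply: set_type_integers_discrete => _ [->|->]; [exists 0%R|exists 1%R].
tfae.
- exact: (H_separable_retract I_ideal X_zero_dim hX discZ
    (@round_rational_continuous R) (@rational_of_integerK R)).
- apply: (H_separable_retract I_ideal X_zero_dim hX disc2 _
    (@integer_of_twoK R)) => z N Nz.
  have := open_nbhs_nbhs (conj (discZ z) (erefl z)).
  by apply: filterS => _ ->; exact: nbhs_singleton Nz.
- have two01 : two0 R <> two1 R.
    by move=> /(congr1 val) /eqP; rewrite eq_sym oner_eq0.
  move=> HS; split.
    apply: (iweight_countable R X_zero_dim hX disc2 two01).
    exact: H_separable_separable I_proper HS.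
  exact: (powers_Hurewicz I_ideal X_zero_dim hX disc2 two01 HS).
- move=> [iwX HX].
  apply: (H_separable_of_powers_Hurewicz R
    (rational_of_integer (integer_of_two (two0 R))) I_ideal I_admissible
    X_zero_dim hX) => //.
  exact: second_countable_initial (second_countable_real R).
Qed.
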